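(* Let $H$ be a real Hilbert space and $\Psi=F+R$, where $R:H\to\mathbb{R}\cup\{\pm\infty\}$ is proper, convex and lower semicontinuous; $F:H\to\mathbb{R}$ is convex and continuously Fréchet differentiable on $\operatorname{int}(\operatorname{dom}F)\supseteq\operatorname{dom}R$; and $\nabla F:H\to H$ is globally $L$-Lipschitz continuous ($L>0$). Suppose that $S_*\ne\emptyset$, let $\Psi^*:=\min_H\Psi$, and suppose that for some $\omega>0$ and $\gamma>0$ $$\Psi(u)-\Psi^*\ge\gamma\,\operatorname{dist}^2(u,S_* )\qquad\text{for all }u\in\operatorname{dom}\Psi\text{ with }\Psi(u)<\Psi^*+\omega .$$ Then there exist constants $C_c,C_d,C_p>0$ and $0<\sigma<1$, independent of $u_0$, $u^*$ and $k$, such that for the sequence $\{u_k\}_k$ generated by the nonmonotone splitting algorithm described in the context there exists $\bar k\in\mathbb{N}$ such that for every $k\ge\bar k$ $$\Psi(u_k)-\Psi^*\le C_c\,\sigma^k\qquad\text{and}\qquad \operatorname{dist}^2(u_k,S_* )\le C_d\,\sigma^k .$$ Further, there exists $u^*\in S_*$ such that $u_k\to u^*$ strongly, and for every $k\ge\bar k$ $$\|u_k-u^*\|^2\le C_p\,\sigma^k .$$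
   Context: For $u\in\operatorname{int}(\operatorname{dom}F)$, $\nabla F(u)\in H$ is the Riesz representative of the derivative $F'(u)$. $\partial R$ is the convex subdifferential. $S_*:=\{u\in H:-\nabla F(u)\in\partial R(u)\}$; in the present convex setting $S_*$ is the (closed, convex) set of minimizers of $\Psi$. For $\alpha>0$: $\operatorname{Prox}_{\frac1\alpha R}(u):=\operatorname{argmin}_{v\in H}\big(R(v)+\frac{\alpha}{2}\|v-u\|^2\big)$, $T_\alpha(u):=\operatorname{Prox}_{\frac1\alpha R}\big(u-\frac1\alpha\nabla F(u)\big)$, and $G_\alpha(u):=\alpha(u-T_\alpha(u))$ (gradient mapping). Nonmonotone splitting algorithm. Parameters: $0<\delta<1$, $m_{\max}\in\mathbb{N}_0$, $\eta>1$, $\alpha_{\sup}>\alpha_{\inf}>0$, $u_0\in H$, $\alpha_0>0$. Memory: $m(0)=0$, $m(k)=\min\{m(k-1)+1,m_{\max}\}$ for $k\ge1$. For $k=0,1,2,\dots$: stop if $G_\alpha(u_k)=0$ for some (equivalently every) $\alpha>0$; otherwise compute a Barzilai–Borwein value $\alpha_k^{BB}$, set $\alpha_{\mathrm{int},k}:=\max\{\alpha_{\inf},\min\{\alpha_{\sup},\alpha_k^{BB}\}\}$ and $\alpha_k:=\alpha_{\mathrm{int},k}\,\eta^{i_k}$, where $i_k\in\mathbb{N}_0$ is the smallest integer such that, with $u_{k+1}:=T_{\alpha_k}(u_k)=u_k-\frac{1}{\alpha_k}G_{\alpha_k}(u_k)$, $$\Psi(u_{k+1})\le\max_{0\le j\le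 m(k)}\Psi(u_{k-j})-\frac{\delta}{\alpha_k}\|G_{\alpha_k}(u_k)\|^2 .$$ Barzilai–Borwein values: $\alpha_0^{BB}:=\alpha_0$; for $k\ge1$, with $s=u_k-u_{k-1}$, $y=\nabla F(u_k)-\nabla F(u_{k-1})$, $z=G_{\alpha_{k-1}}(u_k)-G_{\alpha_{k-1}}(u_{k-1})$, the value $\alpha_k^{BB}$ is one of $\frac{(s,y)}{(s,s)},\ \frac{(y,y)}{(s,y)},\ \frac{(s,z)}{(s,s)},\ \frac{(z,z)}{(s,z)}$, or alternates between the first two, or between the last two (first of the pair for even $k$, second for odd $k$); if a denominator is zero any real value may be used. The problem data and the parameters $\delta,m_{\max},\eta,\alpha_{\inf},\alpha_{\sup}$ are fixed; $\bar k$ may depend on $u_0$. Assertions for all $k$ and about limits refer to the case in which the algorithm does not stop, so that $\{u_k\}_k$ is an infinite sequence. *)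

(* Defs.v *)
(* A real Hilbert space is a complete normed module [H] over a [K : realType]
   with an inner product [ip : {dot H for idfun}] such that
   [ip u u = `|u| ^+ 2]; the last condition, which only links the norm of [H]
   to [ip], is a hypothesis of the theorem. *)
From HB Require Import structures.
From mathcomp Require Import all_boot all_order all_algebra.
From mathcomp Require Import sesquilinear.
From mathcomp Require Import all_classical all_reals all_analysis.

Set Implicit Arguments.
Unset Strict Implicit.
Unset Printing Implicit Defensive.

Import Order.TTheory GRing.Theory Num.Theory.
Import numFieldNormedType.Exports.

Local Open Scope classical_set_scope.
Local Open Scope ring_scope.

Section ConvexAnalysis.
Context {K : realType} {H : completeNormedModType K}.
Implicit Types (R : H -> \bar K) (u v w p : H).

Definition edom R : set H := [set u | (R u < +oo)%E].

Definition proper_ereal R : Prop := edom R !=set0 /\ forall u, R u != -oo%E.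

(* Meant for functions that never take the value -oo (so that the sum on the
   right is never +oo - oo). *)
Definition convex_ereal R : Prop :=
  forall u v (t : K), 0 < t < 1 ->
    (R (t *: u + (1 - t) *: v)%R <= t%:E * R u + (1 - t)%:E * R v)%E.

Definition subdifferential (ip : {dot H for idfun}) R u : set H :=
  [set p | R u \is a fin_num /\
           forall v, (R u + (ip p (v - u))%:E <= R v)%E].

(* The argmin is unique when R is proper, convex, lsc and alpha > 0; the
   default value 0 is only returned when there is no minimizer. *)
Definition prox R (alpha : K) u : H :=
  let obj v := (R v + (alpha / 2 * `|v - u| ^+ 2)%:E)%E in
  xget 0 [set v | forall w, (obj v <= obj w)%E].

End ConvexAnalysis.

Section Gradient.
Context {K : realType} {H : completeNormedModType K}.
Variables (ip : {dot H for idfun}) (F : H -> K).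

Definition grad (u : H) : H := xget 0 [set g | forall h, 'd F u h = ip g h].

(* Since the Riesz map is an isometry, u |-> 'd F u is continuous for the
   operator norm iff grad is continuous. *)
Definition continuously_differentiable : Prop :=
  (forall u, differentiable F u) /\ continuous grad.

End Gradient.

Section Splitting.
Context {K : realType} {H : completeNormedModType K}.
Variables (ip : {dot H for idfun}) (F : H -> K) (R : H -> \bar K).

Definition Psi (u : H) : \bar K := ((F u)%:E + R u)%E.

Definition S_star : set H :=
  [set u | subdifferential ip R u (- grad ip F u)].

(* Attained, hence min_H Psi, as soon as Psi has a minimizer. *)
Definition Psi_star : \bar K := ereal_inf (range Psi).

Definition T_ (alpha : K) (u : H) : H :=
  prox R alpha (u - alpha^-1 *: grad ip F u).

Definition G_ (alpha : K) (u : H) : H := alpha *: (u - T_ alpha u).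

Variables (delta : K) (mmax : nat) (eta alpha_inf alpha_sup alpha0 : K).

Fixpoint memory (k : nat) : nat :=
  if k is k'.+1 then minn (memory k').+1 mmax else 0%N.

Definition stopped (u : H) : Prop := exists2 alpha, 0 < alpha & G_ alpha u = 0.

Definition line_search_test (u : nat -> H) (k : nat) (alpha : K) : Prop :=
  (Psi (T_ alpha (u k)) <=
     \big[maxe/-oo]_(0 <= j < (memory k).+1) Psi (u (k - j)%N)
     - (delta / alpha * `|G_ alpha (u k)| ^+ 2)%:E)%E.

(* a is the quotient n / d, or arbitrary if d = 0 *)
Definition quotient_or_any (n d a : K) : Prop := d != 0 -> a = n / d.

(* The quotient may be chosen anew at every k, which covers the rules that use
   a fixed quotient as well as those alternating between two of them. *)
Definition BB_value (u : nat -> H) (alpha : nat -> K) (k : nat) (a : K) : Prop :=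
  if k is k'.+1 then
    let s := u k - u k' in
    let y := grad ip F (u k) - grad ip F (u k') in
    let z := G_ (alpha k') (u k) - G_ (alpha k') (u k') in
    [\/ quotient_or_any (ip s y) (ip s s) a,
        quotient_or_any (ip y y) (ip s y) a,
        quotient_or_any (ip s z) (ip s s) a |
        quotient_or_any (ip z z) (ip s z) a]
  else a = alpha0.

Definition alpha_int (a : K) : K :=
  Num.max alpha_inf (Num.min alpha_sup a).

(* u is an infinite run: the stopping test fails at every iteration. *)
Definition nonmonotone_splitting (u : nat -> H) : Prop :=
  exists (alphaBB alpha : nat -> K) (i : nat -> nat), forall k : nat,
    [/\ ~ stopped (u k),
        BB_value u alpha k (alphaBB k),
        alpha k = alpha_int (alphaBB k) * eta ^+ i k,
        line_search_test u k (alpha k) /\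
        (forall j, (j < i k)%N ->
           ~ line_search_test u k (alpha_int (alphaBB k) * eta ^+ j)) &
        u k.+1 = T_ (alpha k) (u k)].

End Splitting.

(* Main.v *)
Require Import Defs.
From HB Require Import structures.
From mathcomp Require Import all_boot all_order all_algebra.
From mathcomp Require Import sesquilinear.
From mathcomp Require Import all_classical all_reals all_analysis.
From mathcomp Require Import ring lra zify.

Set Implicit Arguments.
Unset Strict Implicit.
Unset Printing Implicit Defensive.

Import Order.TTheory GRing.Theory Num.Theory.
Import numFieldNormedType.Exports.

Local Open Scope classical_set_scope.
Local Open Scope ring_scope.

(** Write [e k] for the excess of [Psi (u k)] over the minimum, [d k] for the
    distance of [u k] to the minimizers and [D k] for [`|u k - u k.+1|]. The
    proof rests on two inequalities valid at every step with bounded step size.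

    First, the step is sufficient decrease with respect to a window,
    [e k.+1 <= M - c * D k ^+ 2] where [M] is the largest of the last [mmax.+1]
    excesses ([run_decrease]). The step sizes are bounded because a trial step
    size at least [L / (1 - delta)] always passes the test
    ([line_search_test_large], [run_step_size]).

    Second, optimality of the proximal point combined with the gradient
    inequality of [F] at [u k] compares the new point with any competitor
    ([psi_T_le]); taken at minimizers close to [u k] it gives
    [e k.+1 <= A * D k * d k + C * D k ^+ 2] ([run_gap_dist]).

    If moreover [d k ^+ 2 <= kappa * e k], Young's inequality absorbs [d k] into
    [M / 2], the decrease inequality bounds [D k ^+ 2] by [(M - e k.+1) / c], and
    together they yield [e k.+1 <= q * M] with [q < 1] depending only on [kappa],
    [L] and the parameters ([contraction_factor]). A contraction by [q] of a sliding
    maximum over [mmax.+1] terms is geometric decay with any rate [sigma] such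
    that [q <= sigma ^+ mmax.+1] ([windowed_geometric_bound]).

    The growth hypothesis provides [kappa = gamma^-1] only for [e k < omega]. By
    convexity it extends to every sublevel set, with a worse constant
    ([growth_on_sublevel]), so the contraction argument is used twice: once with
    a rate depending on the run to bring the excess below [omega]
    ([run_eventually_near]), and once from there on with the uniform rate
    ([run_rate]). The steps [D k] then decay geometrically as well, so [u] is
    Cauchy, and lower semicontinuity puts its limit among the minimizers.

    The factors in front of the geometric terms depend on the run; enlarging
    [sigma] to [(1 + sigma) / 2] makes them eventually at most [1]
    ([geometric_absorb]), which is why the constants can all be [1].

    Existence of proximal points and of the gradient (the Riesz representer of
    the derivative) both come from minimizing a strongly convex lower
    semicontinuous function over a complete space ([prox_exists]). *)

(** * Real inner product spaces *)

Section InnerProduct.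
Context {K : realType} {H : completeNormedModType K}.
Variable ip : {dot H for idfun}.
Hypothesis ip_norm : forall u, ip u u = `|u| ^+ 2.
Implicit Types u v w : H.

Lemma ipC u v : ip u v = ip v u.
Proof. by rewrite (hermC ip u v) /= expr0 mul1r. Qed.

Lemma ipDl u v w : ip (u + v) w = ip u w + ip v w.
Proof. exact: linearDl. Qed.

Lemma ipNl u v : ip (- u) v = - ip u v.
Proof. exact: linearNl. Qed.

Lemma ipZl (a : K) u v : ip (a *: u) v = a * ip u v.
Proof. exact: linearZl_LR. Qed.

Lemma ipDr u v w : ip w (u + v) = ip w u + ip w v.
Proof. by rewrite ipC ipDl !(ipC w). Qed.

Lemma ipNr u v : ip v (- u) = - ip v u.
Proof. by rewrite ipC ipNl (ipC v). Qed.

Lemma ipZr (a : K) u v : ip v (a *: u) = a * ip v u.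
Proof. by rewrite ipC ipZl (ipC v). Qed.

Definition ipE := (ipDl, ipDr, ipNl, ipNr, ipZl, ipZr).

Lemma sqr_normD u v : `|u + v| ^+ 2 = `|u| ^+ 2 + 2 * ip u v + `|v| ^+ 2.
Proof. by rewrite -!ip_norm !ipE (ipC v u); ring. Qed.

Lemma sqr_normZ (a : K) u : `|a *: u| ^+ 2 = a ^+ 2 * `|u| ^+ 2.
Proof. by rewrite normrZ exprMn real_normK ?num_real. Qed.

(** Cauchy-Schwarz, by expanding the squared norm of [`|v| *: u - `|u| *: v]. *)
Lemma ip_le_norm u v : ip u v <= `|u| * `|v|.
Proof.
have [->|v0] := eqVneq v 0.
  by rewrite -(scale0r (0 : H)) ipZr mul0r mulr_ge0.
have [->|u0] := eqVneq u 0.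
  by rewrite -(scale0r (0 : H)) ipZl mul0r mulr_ge0.
have a0 : 0 < `|u| by rewrite normr_gt0.
have b0 : 0 < `|v| by rewrite normr_gt0.
have := sqr_ge0 (`| `|v| *: u - `|u| *: v|).
rewrite sqr_normD -scaleNr !sqr_normZ !ipE => h.
have {h} : 0 <= 2 * (`|u| * `|v|) * (`|u| * `|v| - ip u v) by lra.
by rewrite pmulr_rge0 ?mulr_gt0 // subr_ge0.
Qed.

(** The negative term is what makes minimizing sequences of a strongly convex
    function Cauchy. *)
Lemma midpoint_identity u v w :
  `|2^-1 *: u + 2^-1 *: v - w| ^+ 2 =
  2^-1 * `|u - w| ^+ 2 + 2^-1 * `|v - w| ^+ 2 - 4^-1 * `|u - v| ^+ 2.
Proof. by rewrite -!ip_norm !ipE (ipC v u) (ipC w u) (ipC w v); field. Qed.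

End InnerProduct.

(** * Tools for minimization and limits *)

Section MinimizationTools.
Context {K : realType} {H : completeNormedModType K}.
Implicit Types u v w p : H.

(** Serves to read off first-order conditions from comparisons along a segment
    without taking derivatives. *)
Lemma ge0_of_small_quadratic (a b : K) :
  (forall t : K, 0 < t < 1 -> 0 <= a * t + b * t ^+ 2) -> 0 <= a.
Proof.
move=> h; rewrite leNgt; apply/negP => a0.
(* small enough for the quadratic term to be at most half of the linear one *)
pose t := - a / (2 * (`|b| - a)).
have nb : 0 <= `|b| by [].
have d0 : 0 < 2 * (`|b| - a) by lra.
have t0 : 0 < t by rewrite divr_gt0 ?oppr_gt0.
have t1 : t < 1 by rewrite ltr_pdivrMr //; lra.
have := h t; rewrite t0 t1 => /(_ isT).
have -> : a * t + b * t ^+ 2 = (a + b * t) * t by ring.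
rewrite pmulr_lge0 //.
apply/negP; rewrite -ltNge.
have tE : t * (2 * (`|b| - a)) = - a by rewrite mulfVK // gt_eqF.
have : b * t <= `|b| * t by rewrite ler_pM2r // ler_norm.
have : `|b| * t <= t * (`|b| - a) by rewrite mulrC ler_pM2l //; lra.
lra.
Qed.

Lemma lsc_cvg_le (f : H -> \bar K) (v : nat -> H) p (b : nat -> K) (l : K) :
  lower_semicontinuous f -> v @ \oo --> p -> b @ \oo --> l ->
  (\forall n \near \oo, f (v n) <= (b n)%:E)%E -> (f p <= l%:E)%E.
Proof.
move=> flsc vp bl fb; rewrite leNgt; apply/negP => lfp.
have [a la afp] : exists2 a : K, l < a & (a%:E < f p)%E.
  case E : (f p) lfp => [y| |] lfp.
  - exists ((l + y) / 2); rewrite ?lte_fin; rewrite lte_fin in lfp; lra.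
  - by exists (l + 1); rewrite ?ltry // ltrDl.
  - by [].
have [V Vp Va] := flsc _ _ afp.
have nV : \forall n \near \oo, V (v n) by exact: vp.
have nb : \forall n \near \oo, b n < a by exact: (cvgr_lt l).
near \oo => n.
have : (a%:E < a%:E :> \bar K)%E.
  apply: (@lt_trans _ _ (b n)%:E); last by rewrite lte_fin; near: n.
  apply: (@lt_le_trans _ _ (f (v n))); last by near: n.
  by apply: Va; near: n.
by rewrite ltxx.
Unshelve. all: by end_near. Qed.

Lemma cvg_sqr_dist (v : nat -> H) p w :
  v @ \oo --> p -> `|v n - w| ^+ 2 @[n --> \oo] --> `|p - w| ^+ 2.
Proof.
move=> vp; rewrite expr2; under eq_fun do rewrite expr2.
have hn : `|v n - w| @[n --> \oo] --> `|p - w|.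
  by apply: cvg_norm; apply: cvgB => //; exact: cvg_cst.
exact: cvgM.
Qed.

(** The form in which minimizing sequences come, the [n]-th term being chosen
    within [n.+1%:R^-1] of the infimum. *)
Lemma cvg_of_harmonic_dist (v : nat -> H) (C : K) :
  (forall n k, `|v n - v k| ^+ 2 <= C * (n.+1%:R^-1 + k.+1%:R^-1)) ->
  exists p, v @ \oo --> p.
Proof.
move=> hv; suff cv : cvg (v @ \oo) by exists (lim (v @ \oo)).
apply: cauchy_cvg; apply: cauchy_exP => e e0.
have C0 : 0 <= C.
  have := le_trans (sqr_ge0 _) (hv 0%N 0%N); rewrite invr1; lra.
have d0 : 0 < e ^+ 2 / (2 * C + 1) by rewrite divr_gt0 ?exprn_gt0 //; lra.
have [N _ hN] : \forall n \near \oo, n.+1%:R^-1 < e ^+ 2 / (2 * C + 1).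
  have := @cvgr_lt _ _ _ _ _ _ (@cvg_harmonic K); exact.
exists (v N); exists N => // k /= Nk; rewrite -ball_normE /=.
rewrite -(@ltr_pXn2r _ 2) ?nnegrE ?normr_ge0 ?(ltW e0) //.
apply: (le_lt_trans (hv N k)).
have hNN := hN N (leqnn _); have hNk := hN k Nk; rewrite /= in hNN hNk.
have -> : e ^+ 2 = (2 * C + 1) * (e ^+ 2 / (2 * C + 1)).
  by rewrite mulrC divfK // gt_eqF //; lra.
set x := N.+1%:R^-1 in hNN *; set y := k.+1%:R^-1 in hNk *.
set d := _ / _ in hNN hNk d0 *.
have : C * (x + y) <= C * (2 * d) by apply: ler_wpM2l => //; lra.
lra.
Qed.

End MinimizationTools.

(** * Proximal points and Riesz representation *)

Section ProxExists.
Context {K : realType} {H : completeNormedModType K}.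
Variable ip : {dot H for idfun}.
Hypothesis ip_norm : forall u, ip u u = `|u| ^+ 2.
Variable R : H -> \bar K.
Hypotheses (R_proper : proper_ereal R) (R_convex : convex_ereal R).
Implicit Types u v w p : H.

Local Notation r v := (fine (R v)).

Lemma properE v : edom R v -> R v = (r v)%:E.
Proof.
move=> Rv; rewrite fineK // fin_numE (lt_eqF Rv) andbT.
by case: R_proper => _ /(_ v).
Qed.

Lemma fine_convex u v (t : K) : 0 < t < 1 -> edom R u -> edom R v ->
  edom R (t *: u + (1 - t) *: v) /\
  r (t *: u + (1 - t) *: v) <= t * r u + (1 - t) * r v.
Proof.
move=> t01 Ru Rv; have := R_convex u v t01.
rewrite (properE Ru) (properE Rv) -!EFinM -EFinD => h.
have d : edom R (t *: u + (1 - t) *: v) by apply: le_lt_trans h (ltry _).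
by split=> //; rewrite -lee_fin -(properE d).
Qed.

Section Minorant.
Hypothesis R_lsc : lower_semicontinuous R.
(** A minorant with linear growth holds for every proper convex lower
    semicontinuous function by separation; here it is always available from a
    subgradient or from continuity of a linear form, so it is assumed. *)
Variables c M : K.
Hypothesis R_minorant : forall v, ((c - M * `|v|)%:E <= R v)%E.

(** The minorant keeps the objective bounded below, its linear decay being
    dominated by the quadratic term. The midpoint of two almost minimizers cannot
    beat the infimum, so by strong convexity they are close to each other; lower
    semicontinuity then passes to the limit. *)
Lemma prox_exists (alpha : K) w : 0 < alpha ->
  exists p, forall v, (R p + (alpha / 2 * `|p - w| ^+ 2)%:E <=
                       R v + (alpha / 2 * `|v - w| ^+ 2)%:E)%E.
Proof.
move=> al0.
pose phi v := r v + alpha / 2 * `|v - w| ^+ 2.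
pose E := [set phi v | v in edom R].
have E0 : E !=set0 by case: R_proper => -[v0 Rv0] _; exists (phi v0), v0.
(* complete the square in [`|v - w|] *)
have phi_ge v : edom R v -> c - `|M| * `|w| - `|M| ^+ 2 / (2 * alpha) <= phi v.
  move=> Rv; have := R_minorant v; rewrite (properE Rv) lee_fin => rv.
  have h1 : M * `|v| <= `|M| * `|v| by rewrite ler_wpM2r // ler_norm.
  have h2 : `|M| * `|v| <= `|M| * (`|v - w| + `|w|).
    by rewrite ler_wpM2l //; have := ler_normD (v - w) w; rewrite subrK.
  have h3 : 0 <= alpha / 2 * (`|v - w| - `|M| / alpha) ^+ 2.
    by rewrite mulr_ge0 ?sqr_ge0 // divr_ge0 // ltW.
  have h4 : alpha / 2 * (`|v - w| - `|M| / alpha) ^+ 2 =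
    alpha / 2 * `|v - w| ^+ 2 - `|M| * `|v - w| + `|M| ^+ 2 / (2 * alpha).
    by field; rewrite gt_eqF.
  rewrite h4 in h3; rewrite /phi; lra.
have Elb : has_lbound E.
  by exists (c - `|M| * `|w| - `|M| ^+ 2 / (2 * alpha)) => _ [v Rv <-]; exact: phi_ge.
pose m := inf E.
have m_le v : edom R v -> m <= phi v.
  by move=> Rv; apply: ge_inf => //; exists v.
have : forall n : nat, exists v, edom R v /\ phi v < m + n.+1%:R^-1.
  move=> n; have n0 : 0 < n.+1%:R^-1 :> K by rewrite invr_gt0.
  by have [_ [v Rv <-] hv] := inf_adherent n0 (conj E0 Elb); exists v.
move=> /choice [v vP].
have gap n k : `|v n - v k| ^+ 2 <= 4 / alpha * (n.+1%:R^-1 + k.+1%:R^-1).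
  have [Rn hn] := vP n; have [Rk hk] := vP k.
  have half : 0 < (2^-1 : K) < 1 by lra.
  have [Rmid rmid] := fine_convex half Rn Rk.
  have := m_le _ Rmid; rewrite /phi.
  have E2 : 1 - 2^-1 = 2^-1 :> K by lra.
  rewrite E2 in rmid *; rewrite (midpoint_identity ip_norm) => hm.
  rewrite /phi in hn hk.
  rewrite mulrAC ler_pdivlMr //.
  by move: hn hk; move: (n.+1%:R^-1) (k.+1%:R^-1) => dn dk; lra.
have [p vp] := cvg_of_harmonic_dist gap.
have Rp : (R p <= (m - alpha / 2 * `|p - w| ^+ 2)%:E)%E.
  apply: (@lsc_cvg_le _ _ R v p
     (fun n => m + n.+1%:R^-1 - alpha / 2 * `|v n - w| ^+ 2)) => //.
    apply: cvgB; last by apply: cvgM; [exact: cvg_cst|exact: cvg_sqr_dist].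
    rewrite -[X in _ --> X]addr0; apply: cvgD; [exact: cvg_cst|exact: cvg_harmonic].
  apply: nearW => n; have [Rn hn] := vP n.
  by rewrite (properE Rn) lee_fin lerBrDr ltW.
exists p => u; have pdom : edom R p by apply: le_lt_trans Rp (ltry _).
have [Ru|Ru] := ltP (R u) +oo%E; last first.
  by move: Ru; rewrite leye_eq => /eqP ->; rewrite addye // leey.
rewrite (properE pdom) in Rp *; rewrite (properE Ru) -!EFinD lee_fin.
have := m_le _ Ru; rewrite /phi lee_fin in Rp *; lra.
Qed.

(** Fermat's rule for the proximal point: along the segment from [p] to [v]
    the objective is at most a quadratic polynomial whose slope at [p] must be
    nonnegative. *)
Lemma prox_variational (alpha : K) w : 0 < alpha ->
  edom R (prox R alpha w) /\ forall v, edom R v ->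
  r (prox R alpha w) + alpha * ip (w - prox R alpha w) (v - prox R alpha w)
    <= r v.
Proof.
move=> al0; have [q qmin] := prox_exists w al0.
rewrite /prox /=; set A := [set _ | _].
have := xgetPex 0 (ex_intro A q qmin); set p := xget 0 A => pmin.
have pdom : edom R p.
  case: R_proper => -[v0 Rv0] _; have := pmin v0.
  rewrite (properE Rv0) -EFinD => h.
  rewrite /edom /= ltNge leye_eq; apply/negP => /eqP Rp.
  by move: h; rewrite Rp addye.
split=> // v Rv; rewrite -subr_ge0.
apply: (@ge0_of_small_quadratic K _ (alpha / 2 * `|v - p| ^+ 2)) => t t01.
have [Rt rt] := fine_convex t01 Rv pdom.
have := pmin (t *: v + (1 - t) *: p).
rewrite (properE Rt) (properE pdom) -!EFinD lee_fin.
have -> : t *: v + (1 - t) *: p - w = (p - w) + t *: (v - p).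
  by rewrite scalerBl scale1r scalerBr addrCA addrAC.
rewrite (sqr_normD ip_norm (p - w)) sqr_normZ ipZr.
have -> : ip (w - p) (v - p) = - ip (p - w) (v - p) by rewrite -ipNl opprB.
rewrite /=; lra.
Qed.

End Minorant.
End ProxExists.

Section Riesz.
Context {K : realType} {H : completeNormedModType K}.
Variable ip : {dot H for idfun}.
Hypothesis ip_norm : forall u, ip u u = `|u| ^+ 2.

(** The representer of [l] is the proximal point of [- l] at the origin: its
    variational inequality reads [l h <= ip p h] for every [h], hence equality
    by replacing [h] by [- h]. *)
Lemma riesz (l : {linear H -> K}) : continuous l ->
  exists g, forall h, l h = ip g h.
Proof.
move=> lc; pose R v := (- l v)%:E.
have lZ (a : K) x : l (a *: x) = a * l x by rewrite linearZ.
have Rp : proper_ereal R by split=> //; exists 0; rewrite /edom /= ltry.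
have Rc : convex_ereal R.
  move=> u v t _; rewrite /R -!EFinM -EFinD lee_fin linearD !lZ; lra.
have Rl : lower_semicontinuous R.
  move=> x a; rewrite lte_fin => ax.
  exists [set y | a < - l y] => //.
  have : - l y @[y --> x] --> - l x by apply: cvgN; exact: lc.
  by move/cvgr_gt; apply.
have [M M0 lM] : exists2 M, 0 < M & forall v, `|l v| <= M * `|v|.
  by apply: pinfty_ex_gt0; apply/linear_boundedP/linear_bounded_continuous.
have Rm v : ((0 - M * `|v|)%:E <= R v)%E.
  by rewrite lee_fin; have := lM v; have := ler_norm (l v); lra.
have [_ hp] := prox_variational ip_norm Rp Rc Rl Rm 0 ltr01.
exists (prox R 1 0) => h; set p := prox _ _ _ in hp *.
have key z : l z <= ip p z.
  have := hp (p + z) (ltry _).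
  by rewrite /R /= (addrC p z) addrK sub0r ipNl linearD /=; lra.
by have := key h; have := key (- h); rewrite linearN ipNr /=; lra.
Qed.

End Riesz.

(** * The gradient of a smooth convex function *)

Section Gradient.
Context {K : realType} {H : completeNormedModType K}.
Variable ip : {dot H for idfun}.
Hypothesis ip_norm : forall u, ip u u = `|u| ^+ 2.
Variables (F : H -> K) (L : K).
Hypothesis F_convex : convex_function [set: convex_lmodType H] F.
Hypothesis F_C1 : continuously_differentiable ip F.
Implicit Types u v w : H.

Lemma gradE u h : 'd F u h = ip (grad ip F u) h.
Proof.
have [dF _] := F_C1; have := diff_continuous (dF u).
move=> /(riesz ip_norm)[g gP].
exact: (xgetPex 0 (ex_intro (fun g => forall h, 'd F u h = ip g h) g gP)).
Qed.

Lemma convex_segment u v (t : K) : 0 < t < 1 ->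
  F (t *: u + (1 - t) *: v) <= t * F u + (1 - t) * F v.
Proof.
move=> /andP[t0 t1].
exact: (F_convex (Itv01 (ltW t0) (ltW t1)) (in_setT u) (in_setT v)).
Qed.

(** The difference quotients of a convex function along [w] at times below [1]
    are at most the increment over time [1], and so is their limit. *)
Lemma grad_le_increment u w : 'd F u w <= F (u + w) - F u.
Proof.
have [dF _] := F_C1; rewrite -deriveE //.
have := diff_derivable (v := w) (dF u).
rewrite /derivable => cF.
rewrite leNgt; apply/negP => lt.
have : (fun h => h^-1 *: ((F \o shift u) (h *: w) - F u)) @ 0^' --> 'D_w F u by [].
move=> /cvgr_gt /(_ _ lt) /nbhs_ballP[e /= e0 he].
have e2 : 0 < e / 2 by rewrite divr_gt0.
pose t := Num.min (e / 2) 2^-1.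
have t0 : 0 < t by rewrite lt_min e2 invr_gt0 ltr0n.
have t1 : t < 1 by rewrite gt_min; apply/orP; right; lra.
have te : t < e by rewrite gt_min; apply/orP; left; lra.
have := he t; rewrite /ball /= sub0r normrN gtr0_norm // => /(_ te).
rewrite gt_eqF // => /(_ isT).
have -> : t *: w + u = t *: (u + w) + (1 - t) *: u.
  by rewrite scalerDr scalerBl scale1r (addrC (t *: u)) -addrA (addrC (t *: u)) subrK.
have t01 : 0 < t < 1 by rewrite t0 t1.
have := convex_segment (u + w) u t01; rewrite /GRing.scale /=.
set a := F (_ + _ : H) => ha; rewrite ltNge ler_pdivrMl //.
by apply/negP; rewrite negbK; lra.
Qed.

Lemma first_order_lower u v : F u + ip (grad ip F u) (v - u) <= F v.
Proof.
by have := grad_le_increment u (v - u); rewrite gradE (addrC u) subrK; lra.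
Qed.

Hypothesis gradF_lip : L.-lipschitz (grad ip F).

(** The sharp constant is [L / 2], but [L] only costs a change of constants
    and follows from the gradient inequality at [v], without integrating. *)
Lemma first_order_upper u v :
  F v <= F u + ip (grad ip F u) (v - u) + L * `|v - u| ^+ 2.
Proof.
have h1 := first_order_lower v u.
have h2 : `|grad ip F v - grad ip F u| <= L * `|v - u|.
  exact: (@gradF_lip (v, u) (conj I I)).
have h3 := ip_le_norm ip_norm (grad ip F v - grad ip F u) (v - u).
have h4 : `|grad ip F v - grad ip F u| * `|v - u| <= L * `|v - u| ^+ 2.
  by rewrite expr2 mulrA ler_wpM2r.
have h5 : ip (grad ip F v) (u - v) = - ip (grad ip F v) (v - u).
  by rewrite -ipNr opprB.
have h6 : ip (grad ip F v) (v - u) <=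
    ip (grad ip F u) (v - u) + L * `|v - u| ^+ 2.
  by rewrite -lerBlDl -ipNl -ipDl; exact: le_trans h3 h4.
rewrite h5 in h1.
by rewrite -addrA -lerBlDl; apply: le_trans h6; rewrite lerBlDl -lerBlDr.
Qed.

End Gradient.

(** * Distance to a set, minimizers and the proximal gradient step *)

Section DistanceToSet.
Context {K : realType} {H : completeNormedModType K}.
Variable S : set H.
Hypothesis S0 : S !=set0.
Implicit Types u v s : H.

Local Notation D u := (fine (edist_inf S u)).

Lemma edist_inf_le_norm u s : S s -> (edist_inf S u <= `|u - s|%:E)%E.
Proof.
move=> Ss; apply/lee_addgt0Pr => e e0.
apply: (@le_trans _ _ (edist (u, s))).
  by apply: ereal_inf_lbound; exists s.
rewrite -EFinD; apply: edist_fin => /=.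
  by rewrite ltr_wpDl.
by rewrite -ball_normE /= ltrDl.
Qed.

Lemma edist_infE u : edist_inf S u = (D u)%:E.
Proof.
have [s Ss] := S0; rewrite fineK // ge0_fin_numE ?edist_inf_ge0 //.
exact: le_lt_trans (edist_inf_le_norm u Ss) (ltry _).
Qed.

Lemma dist_ge0 u : 0 <= D u.
Proof. by rewrite fine_ge0 ?edist_inf_ge0. Qed.

Lemma dist_le_norm u s : S s -> D u <= `|u - s|.
Proof. by move=> Ss; rewrite -lee_fin -edist_infE edist_inf_le_norm. Qed.

Lemma dist_approx u (e : K) : 0 < e -> exists2 s, S s & `|u - s| < D u + e.
Proof.
move=> e0; have : (edist_inf S u < (D u + e)%:E)%E.
  by rewrite edist_infE lte_fin /= ltrDl.
move=> /ereal_inf_lt[_ [s Ss <-]] /edist_lt_ball; rewrite -ball_normE /=.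
by exists s.
Qed.

Lemma dist_triangle u v : D u <= `|u - v| + D v.
Proof.
apply/ler_addgt0Pr => e e0; have [s Ss vs] := dist_approx v e0.
apply: (le_trans (dist_le_norm u Ss)).
rewrite -addrA (le_trans (ler_distD v _ _)) // lerD2l ltW //.
Qed.

End DistanceToSet.

Section CompositeProblem.
Context {K : realType} {H : completeNormedModType K}.
Variable ip : {dot H for idfun}.
Hypothesis ip_norm : forall u, ip u u = `|u| ^+ 2.
Variables (F : H -> K) (R : H -> \bar K) (L : K).
Hypotheses (R_proper : proper_ereal R) (R_convex : convex_ereal R).
Hypothesis R_lsc : lower_semicontinuous R.
Hypothesis F_convex : convex_function [set: convex_lmodType H] F.
Hypothesis F_C1 : continuously_differentiable ip F.
Hypothesis L_gt0 : 0 < L.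
Hypothesis gradF_lip : L.-lipschitz (grad ip F).
Implicit Types u v s : H.

Local Notation r u := (fine (R u)).
Local Notation psi u := (F u + r u).
Local Notation nF := (grad ip F).
Local Notation S := (S_star ip F R).

Lemma PsiE u : edom R u -> Psi F R u = (psi u)%:E.
Proof. by move=> Ru; rewrite /Psi (properE R_proper Ru) /= EFinD. Qed.

Lemma Psi_Ndom u : ~ edom R u -> Psi F R u = +oo%E.
Proof.
move=> /negP; rewrite -leNgt leye_eq => /eqP Ru.
by rewrite /Psi Ru addey.
Qed.

Lemma edom_Psi u : edom (Psi F R) u <-> edom R u.
Proof.
split=> [|Ru]; last by rewrite /edom /= PsiE // ltry.
by rewrite /edom /=; apply: contraTT; move=> /negP/Psi_Ndom ->; rewrite ltxx.
Qed.

Lemma S_star_dom s : S s -> edom R s.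
Proof. by move=> [+ _]; rewrite /edom /= fin_numE => /andP[_]; rewrite ltey. Qed.

Lemma S_star_subgradient s v : S s -> edom R v -> r s - ip (nF s) (v - s) <= r v.
Proof.
move=> Ss Rv; have [_ /(_ v)] := Ss.
by rewrite (properE R_proper (S_star_dom Ss)) (properE R_proper Rv) -EFinD lee_fin
  ipNl.
Qed.

Lemma S_star_minimizer s v : S s -> edom R v -> psi s <= psi v.
Proof.
move=> Ss Rv; have := S_star_subgradient Ss Rv.
by have := first_order_lower ip_norm F_convex F_C1 s v; lra.
Qed.

(** Fermat's rule: moving from [s] towards [v] by a fraction [t] changes [Psi] by
    at most [t] times the gap of the subgradient inequality plus a multiple of
    [t ^+ 2]. *)
Lemma minimizer_S_star s : edom R s ->
  (forall v, edom R v -> psi s <= psi v) -> S s.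
Proof.
move=> Rs smin; split; first by rewrite (properE R_proper Rs).
move=> v; rewrite ipNl.
have [Rv|/negP] := pselect (edom R v); last first.
  by rewrite -leNgt leye_eq => /eqP ->; rewrite leey.
rewrite (properE R_proper Rs) (properE R_proper Rv) -EFinD lee_fin /= -subr_ge0.
apply: (@ge0_of_small_quadratic K _ (L * `|v - s| ^+ 2)) => t t01.
have [Rt rt] := fine_convex R_proper R_convex t01 Rv Rs.
have := smin _ Rt.
have := first_order_upper ip_norm F_convex F_C1 gradF_lip s (t *: v + (1 - t) *: s).
have -> : t *: v + (1 - t) *: s - s = t *: (v - s).
  by rewrite scalerBl scale1r scalerBr addrCA (addrC s) addrK.
rewrite sqr_normZ ipZr.
move: rt; move: (F _) (fine (R (_ + _))) => x y; lra.
Qed.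

Lemma Psi_starE s : S s -> Psi_star F R = (psi s)%:E.
Proof.
move=> Ss; apply/eqP; rewrite eq_le; apply/andP; split.
  by apply: ereal_inf_lbound; exists s => //; rewrite PsiE //; exact: S_star_dom.
apply: le_ereal_inf_tmp => _ [v _ <-].
have [Rv|/Psi_Ndom ->] := pselect (edom R v); last by rewrite leey.
by rewrite PsiE // lee_fin; exact: S_star_minimizer.
Qed.

Lemma minorant_of_S_star s : S s -> forall v,
  (((r s - `|nF s| * `|s|) - `|nF s| * `|v|)%:E <= R v)%E.
Proof.
move=> Ss v; have [Rv|/negP] := pselect (edom R v); last first.
  by rewrite -leNgt leye_eq => /eqP ->; rewrite leey.
rewrite (properE R_proper Rv) lee_fin; have := S_star_subgradient Ss Rv.
have := ip_le_norm ip_norm (nF s) (v - s).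
have : `|nF s| * `|v - s| <= `|nF s| * (`|v| + `|s|).
  by rewrite ler_wpM2l // ler_normB.
lra.
Qed.

Section Step.
Hypothesis S0 : S !=set0.
Variables (alpha : K) (u : H).
Hypothesis alpha_gt0 : 0 < alpha.

Local Notation T := (T_ ip F R alpha u).

(** The variational inequality of the proximal point says that
    [G_alpha u - grad F u] is a subgradient of [R] at [T_alpha u]. *)
Lemma T_variational :
  edom R T /\
  forall v, edom R v -> r T + ip (G_ ip F R alpha u - nF u) (v - T) <= r v.
Proof.
have [s Ss] := S0.
have [d h] := prox_variational ip_norm R_proper R_convex R_lsc
  (minorant_of_S_star Ss) (u - alpha^-1 *: nF u) alpha_gt0.
split=> // v Rv; have := h v Rv; rewrite -ipZl.
rewrite -/(T_ ip F R alpha u) /G_.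
have -> // : alpha *: (u - alpha^-1 *: nF u - T) = alpha *: (u - T) - nF u.
by rewrite addrAC scalerBr scalerA mulfV ?gt_eqF // scale1r.
Qed.

Lemma T_dom : edom R T.
Proof. by have [] := T_variational. Qed.

(** The three-point inequality behind both the decrease and the gap estimates:
    sum the subgradient inequality of [R] at [T] and the upper and lower
    first-order bounds of [F] around [u]; the gradient of [F] cancels. *)
Lemma psi_T_le v : edom R v ->
  psi T <= psi v + ip (G_ ip F R alpha u) (T - v) + L * `|u - T| ^+ 2.
Proof.
move=> Rv; have [_ /(_ v Rv) h1] := T_variational.
have h2 := first_order_upper ip_norm F_convex F_C1 gradF_lip u T.
have h3 := first_order_lower ip_norm F_convex F_C1 u v.
rewrite distrC in h2.
have e1 : ip (G_ ip F R alpha u - nF u) (v - T) =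
    - ip (G_ ip F R alpha u) (T - v) + ip (nF u) (T - v).
  by rewrite ipDl ipNl -(opprB T v) !ipNr opprK.
have e2 : ip (nF u) (T - v) = ip (nF u) (T - u) - ip (nF u) (v - u).
  by rewrite -ipNr -ipDr opprB addrA subrK.
rewrite e1 in h1.
set a := ip _ (T - v) in e1 h1 *; set b := ip _ (T - v) in e1 e2 h1 *.
lra.
Qed.

Lemma psi_T_decrease : edom R u ->
  psi T <= psi u - (alpha - L) * `|u - T| ^+ 2.
Proof.
move=> Ru; have := psi_T_le Ru.
rewrite /G_ ipZl -(opprB u T) ipNr ip_norm; lra.
Qed.

Lemma psi_T_gap s : S s ->
  psi T - psi s <= alpha * `|u - T| * `|u - s| + L * `|u - T| ^+ 2.
Proof.
move=> Ss; have := psi_T_le (S_star_dom Ss).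
have -> : T - s = - (u - T) + (u - s) by rewrite opprB addrA subrK.
rewrite ipDr ipNr {1 2}/G_ !ipZl ip_norm => h1.
have h2 := ip_le_norm ip_norm (u - T) (u - s).
have h3 : alpha * ip (u - T) (u - s) <= alpha * `|u - T| * `|u - s|.
  by rewrite -mulrA ler_pM2l.
have h4 : 0 <= alpha * `|u - T| ^+ 2 by rewrite mulr_ge0 ?sqr_ge0 // ltW.
lra.
Qed.

End Step.
End CompositeProblem.

(** * Real sequences with windowed decrease *)

Section WindowedDecrease.
Context {K : realType}.
Implicit Types (e : nat -> K) (m N : nat).

(** With [q = sigma = 1] this is boundedness, otherwise geometric decay. The
    constant is any bound for the first window; a step looks back by at most [m],
    which loses [sigma ^- m], and gains [q <= sigma ^+ m.+1]. *)
Lemma windowed_geometric_bound e m N (q sigma : K) :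
  0 <= q -> 0 < sigma <= 1 -> q <= sigma ^+ m.+1 ->
  (forall k, (N <= k)%N -> 0 <= e k) ->
  (forall k, (N + m <= k)%N -> exists2 j, (j <= m)%N & e k.+1 <= q * e (k - j)%N) ->
  exists2 A, 0 <= A & forall k, (N <= k)%N -> e k <= A * sigma ^+ k.
Proof.
move=> q0 /andP[s0 s1] qs e0 erec.
pose A := \sum_(j < (N + m).+1) `|e j| / sigma ^+ j.
have term_ge0 j : 0 <= `|e j| / sigma ^+ j by rewrite divr_ge0 // exprn_ge0 // ltW.
have A0 : 0 <= A by rewrite sumr_ge0.
exists A => //; elim/ltn_ind => k IH Nk.
have [kNm|] := leqP k (N + m).
  rewrite -ler_pdivrMr ?exprn_gt0 //.
  have kNm' : (k < (N + m).+1)%N by [].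
  apply: (@le_trans _ _ (`|e k| / sigma ^+ k)).
    by rewrite ler_wpM2r ?ler_norm // invr_ge0 exprn_ge0 // ltW.
  by rewrite /A (bigD1 (Ordinal kNm')) //= lerDl sumr_ge0.
case: k IH Nk => // k IH Nk; rewrite ltnS => Nmk.
have [j jm ej] := erec k Nmk.
have jk : (k - j < k.+1)%N by lia.
have Njk : (N <= k - j)%N by lia.
apply: (le_trans ej); apply: (@le_trans _ _ (q * (A * sigma ^+ (k - j)))).
  by rewrite ler_wpM2l // IH.
rewrite mulrCA ler_wpM2l //.
apply: (@le_trans _ _ (sigma ^+ m.+1 * sigma ^+ (k - j))).
  by rewrite ler_wpM2r // exprn_ge0 // ltW.
by rewrite -exprD; apply: ler_wiXn2l => //; [exact: ltW|lia].
Qed.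

(** By Bernoulli's inequality [1 - x] works for [x] small compared with
    [(1 - q) / m]. *)
Lemma pow_below_one (q : K) m : q < 1 ->
  exists2 sigma, 0 < sigma < 1 & q <= sigma ^+ m.
Proof.
move=> q1; pose x := Num.min 2^-1 ((1 - q) / m.+1%:R).
have m0 : 0 < m.+1%:R :> K by [].
have x0 : 0 < x by rewrite lt_min invr_gt0 ltr0n divr_gt0 // subr_gt0.
have xm : x * m.+1%:R <= 1 - q.
  by rewrite -ler_pdivlMr // ge_min lexx orbT.
have x2 : x <= 2^-1 by rewrite ge_min lexx.
exists (1 - x); first by apply/andP; split; lra.
have bern n : 1 - n%:R * x <= (1 - x) ^+ n.
  elim: n => [|n IH]; first by rewrite mul0r subr0 expr0.
  rewrite exprS -natr1.
  have : (1 - x) * (1 - n%:R * x) <= (1 - x) * (1 - x) ^+ n.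
    by rewrite ler_wpM2l //; lra.
  have : 0 <= n%:R * x ^+ 2 by rewrite mulr_ge0 ?sqr_ge0.
  set y := _ ^+ n; set z := n%:R; lra.
apply: le_trans (bern m).
by move: xm; rewrite -natr1; move: x0; set z := m%:R; lra.
Qed.

Lemma geometric_absorb (A sigma tau : K) : 0 <= A -> 0 < sigma < tau ->
  exists N, forall k, (N <= k)%N -> A * sigma ^+ k <= tau ^+ k.
Proof.
move=> A0 /andP[s0 st]; have t0 : 0 < tau by apply: lt_trans st.
have z01 : `|sigma / tau| < 1.
  by rewrite gtr0_norm ?divr_gt0 // ltr_pdivrMr // mul1r.
have : (fun k => A * (sigma / tau) ^+ k) @ \oo --> A * 0.
  by apply: cvgM; [exact: cvg_cst|exact: cvg_expr].
rewrite mulr0 => /cvgr_lt /(_ _ ltr01) [N _ hN].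
exists N => k Nk; have := hN k Nk => /=.
by rewrite expr_div_n mulrA ltr_pdivrMr ?exprn_gt0 // mul1r => /ltW.
Qed.

Lemma cvg0_of_geometric e N (A sigma eps : K) : 0 < sigma < 1 -> 0 < eps ->
  (forall k, (N <= k)%N -> e k <= A * sigma ^+ k) ->
  exists N', forall k, (N' <= k)%N -> e k < eps.
Proof.
move=> /andP[s0 s1] eps0 he.
have : (fun k => A * sigma ^+ k) @ \oo --> A * 0.
  by apply: cvgM; [exact: cvg_cst|apply: cvg_expr; rewrite gtr0_norm].
rewrite mulr0 => /cvgr_lt /(_ _ eps0) [N' _ hN'].
exists (maxn N N') => k; rewrite geq_max => /andP[Nk N'k].
exact: le_lt_trans (he k Nk) (hN' k N'k).
Qed.

(** Young's inequality gives [A * D * d <= M / 2 + kappa * A ^+ 2 / 2 * D ^+ 2],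
    hence [e' <= M / 2 + P * c * D ^+ 2], and the decrease inequality bounds
    [c * D ^+ 2] by [M - e']; then solve for [e']. *)
Lemma contraction_factor (e' M D d A C c kappa P : K) :
  P = (kappa * A ^+ 2 / 2 + C) / c ->
  0 < kappa -> 0 < A -> 0 < C -> 0 < c ->
  0 <= M -> d ^+ 2 <= kappa * M ->
  e' <= A * D * d + C * D ^+ 2 -> e' <= M - c * D ^+ 2 ->
  e' <= (2^-1 + P) / (1 + P) * M.
Proof.
move=> PE k0 A0 C0 c0 M0 dM h1 h2.
have P0 : 0 < P by rewrite PE divr_gt0 // addr_gt0 // !mulr_gt0.
have PcE : P * c = kappa * A ^+ 2 / 2 + C by rewrite PE divfK // gt_eqF.
rewrite mulrAC ler_pdivlMr; last lra.
have young : A * D * d <= M / 2 + kappa * A ^+ 2 / 2 * D ^+ 2.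
  have : 0 <= kappa^-1 / 2 * (kappa * A * D - d) ^+ 2.
    by rewrite mulr_ge0 ?sqr_ge0 // divr_ge0 // invr_ge0 ltW.
  have -> : kappa^-1 / 2 * (kappa * A * D - d) ^+ 2 =
      kappa * A ^+ 2 / 2 * D ^+ 2 - A * D * d + kappa^-1 * d ^+ 2 / 2.
    by field; rewrite gt_eqF.
  have : kappa^-1 * d ^+ 2 <= M by rewrite ler_pdivrMl.
  lra.
have : P * e' <= P * (M - c * D ^+ 2) by rewrite ler_pM2l.
have -> : P * (M - c * D ^+ 2) = P * M - P * c * D ^+ 2 by ring.
rewrite PcE; lra.
Qed.

End WindowedDecrease.

Section SequenceRates.
Context {K : realType}.
Implicit Types (e d D : nat -> K) (m N : nat).

Lemma windowed_linear_rate e d D m N (A C c kappa P sigma : K) :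
  P = (kappa * A ^+ 2 / 2 + C) / c ->
  0 < kappa -> 0 < A -> 0 < C -> 0 < c -> 0 < sigma <= 1 ->
  (2^-1 + P) / (1 + P) <= sigma ^+ m.+1 ->
  (forall k, (N <= k)%N -> 0 <= e k /\ d k ^+ 2 <= kappa * e k) ->
  (forall k, (N <= k)%N -> e k.+1 <= A * D k * d k + C * D k ^+ 2) ->
  (forall k, (N + m <= k)%N -> exists j, [/\ (j <= m)%N, e k <= e (k - j)%N &
     e k.+1 <= e (k - j)%N - c * D k ^+ 2]) ->
  exists2 B, 0 <= B & forall k, (N <= k)%N -> e k <= B * sigma ^+ k.
Proof.
move=> PE k0 A0 C0 c0 s01 qs ed gap dec.
have P0 : 0 < P by rewrite PE divr_gt0 // addr_gt0 // !mulr_gt0.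
apply: (windowed_geometric_bound _ s01 qs).
- by rewrite divr_ge0 // addr_ge0 // ?ltW.
- by move=> k /ed[].
move=> k Nk; have [j [jm ek ek1]] := dec k Nk.
have Nk' : (N <= k)%N by exact: leq_trans (leq_addr m N) Nk.
have Nkj : (N <= k - j)%N by clear -Nk jm; lia.
have [ek0 dk] := ed k Nk'; have [ekj0 _] := ed _ Nkj.
have dM : d k ^+ 2 <= kappa * e (k - j)%N.
  by rewrite (le_trans dk) // ler_pM2l.
by exists j => //; exact: contraction_factor PE k0 A0 C0 c0 ekj0 dM (gap k Nk') ek1.
Qed.

End SequenceRates.

Section GeometricSteps.
Context {K : realType} {H : completeNormedModType K}.

(** The step lengths are at most a multiple of [rho ^+ k] with
    [rho = Num.sqrt sigma]; summing the tail of the geometric series costs the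
    factor [(1 - rho)^-1], squared at the end. *)
Lemma cvg_of_geometric_steps (u : nat -> H) N (Q sigma : K) :
  0 <= Q -> 0 < sigma < 1 ->
  (forall k, (N <= k)%N -> `|u k - u k.+1| ^+ 2 <= Q * sigma ^+ k) ->
  exists2 p, u @ \oo --> p &
    forall k, (N <= k)%N ->
      `|u k - p| ^+ 2 <= Q / (1 - Num.sqrt sigma) ^+ 2 * sigma ^+ k.
Proof.
move=> Q0 /andP[s0 s1] hu.
pose rho := Num.sqrt sigma; pose a := Num.sqrt Q.
have r0 : 0 < rho by rewrite sqrtr_gt0.
have r1 : rho < 1 by rewrite -sqrtr1 ltr_sqrt.
have a0 : 0 <= a by rewrite sqrtr_ge0.
have rho2 : rho ^+ 2 = sigma by rewrite sqr_sqrtr // ltW.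
have a2 : a ^+ 2 = Q by rewrite sqr_sqrtr.
have step k : (N <= k)%N -> `|u k - u k.+1| <= a * rho ^+ k.
  move=> Nk; rewrite -(@ler_pXn2r _ 2) ?nnegrE ?normr_ge0 //; last first.
    by rewrite mulr_ge0 // exprn_ge0 // ltW.
  by rewrite exprMn a2 exprAC rho2; exact: hu.
pose b := a / (1 - rho).
have b0 : 0 <= b by rewrite divr_ge0 // subr_ge0 ltW.
have bE : b * (1 - rho) = a by rewrite divfK // subr_eq0 gt_eqF.
have tail k n : (N <= k)%N -> `|u k - u (k + n)%N| <= b * (rho ^+ k - rho ^+ (k + n)).
  move=> Nk; elim: n => [|n IH]; first by rewrite addn0 !subrr normr0 mulr0.
  rewrite addnS; apply: le_trans (ler_distD (u (k + n)%N) _ _) _.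
  apply: le_trans (lerD IH (step _ _)) _; first by lia.
  by rewrite exprS -bE; set x := rho ^+ (k + n); set y := rho ^+ k; lra.
have tail' k n : (N <= k)%N -> (k <= n)%N -> `|u k - u n| <= b * rho ^+ k.
  move=> Nk kn; rewrite -(subnKC kn); apply: le_trans (tail k _ Nk) _.
  by rewrite ler_wpM2l // gerBl exprn_ge0 // ltW.
have [p up] : exists p : H, u @ \oo --> p.
  suff cu : cvg (u @ \oo) by exists (lim (u @ \oo)).
  apply: cauchy_cvg; apply: cauchy_exP => eps eps0.
  have : (fun k => b * rho ^+ k) @ \oo --> b * 0.
    by apply: cvgM; [exact: cvg_cst|apply: cvg_expr; rewrite gtr0_norm].
  rewrite mulr0 => /cvgr_lt /(_ _ eps0) [N' _ hN'].
  exists (u (maxn N N')); exists (maxn N N') => // k /= kN.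
  rewrite -ball_normE /=; apply: le_lt_trans (tail' _ _ _ kN) _.
    exact: leq_maxl.
  by apply: hN'; exact: leq_maxr.
exists p => // k Nk.
have hk : `|u k - p| <= b * rho ^+ k.
  have hc : `|u k - u n| @[n --> \oo] --> `|u k - p|.
    by apply: cvg_norm; apply: cvgB => //; exact: cvg_cst.
  apply: (closed_cvg (fun x : K => x <= b * rho ^+ k) _ _ _ hc).
    exact: closed_le.
  by exists k => // n /= kn; exact: tail'.
have -> : Q / (1 - rho) ^+ 2 * sigma ^+ k = (b * rho ^+ k) ^+ 2.
  by rewrite exprMn expr_div_n a2 -rho2 -!exprM mulnC.
by rewrite ler_pXn2r ?nnegrE ?normr_ge0 // mulr_ge0 // exprn_ge0 // ltW.
Qed.

End GeometricSteps.

(** * Step sizes and the two inequalities along a run *)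

Lemma memory_le m k : (memory m k <= m)%N.
Proof. by case: k => [|k] //=; rewrite geq_minr. Qed.

Section LineSearch.
Context {K : realType} {H : completeNormedModType K}.
Variable ip : {dot H for idfun}.
Hypothesis ip_norm : forall u, ip u u = `|u| ^+ 2.
Variables (F : H -> K) (R : H -> \bar K) (L : K).
Hypotheses (R_proper : proper_ereal R) (R_convex : convex_ereal R).
Hypothesis R_lsc : lower_semicontinuous R.
Hypothesis F_convex : convex_function [set: convex_lmodType H] F.
Hypothesis F_C1 : continuously_differentiable ip F.
Hypothesis L_gt0 : 0 < L.
Hypothesis gradF_lip : L.-lipschitz (grad ip F).
Hypothesis S0 : S_star ip F R !=set0.
Variables (delta : K) (mmax : nat) (eta alpha_inf alpha_sup : K).
Hypotheses (delta_01 : 0 < delta < 1) (eta_gt1 : 1 < eta).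
Hypotheses (alpha_inf_gt0 : 0 < alpha_inf) (alpha_inf_sup : alpha_inf < alpha_sup).

Local Notation r u := (fine (R u)).
Local Notation psi u := (F u + r u).
Local Notation S := (S_star ip F R).
Local Notation T alpha u := (T_ ip F R alpha u).
Local Notation G alpha u := (G_ ip F R alpha u).

Lemma sqr_G (alpha : K) u : 0 < alpha ->
  delta / alpha * `|G alpha u| ^+ 2 = delta * alpha * `|u - T alpha u| ^+ 2.
Proof. by move=> a0; rewrite sqr_normZ; field; rewrite gt_eqF. Qed.

(** For such a step size the decrease of [psi_T_decrease] already beats the
    current value, hence the maximum over the window. If [u k] lies outside the
    domain of [R] the maximum is [+oo]. *)
Lemma line_search_test_large (u : nat -> H) k (alpha : K) :
  L / (1 - delta) <= alpha -> line_search_test ip F R delta mmax u k alpha.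
Proof.
have /andP[d0 d1] := delta_01; have d1' : 0 < 1 - delta by rewrite subr_gt0.
move=> La; have a0 : 0 < alpha by apply: lt_le_trans La; rewrite divr_gt0.
have dom := T_dom ip_norm R_proper R_convex R_lsc S0 (u k) a0.
have le_max : (Psi F R (u k) <=
    \big[maxe/-oo]_(0 <= j < (memory mmax k).+1) Psi F R (u (k - j)%N))%E.
  by rewrite big_mkord; apply: (bigmax_sup ord0) => //=; rewrite subn0.
apply: le_trans (leeB le_max (lexx _)).
rewrite (PsiE F R_proper dom).
have [Ru|/(Psi_Ndom F) ->] := pselect (edom R (u k)); last by rewrite leey.
rewrite (PsiE F R_proper Ru) -EFinB lee_fin sqr_G //.
apply: (le_trans (psi_T_decrease ip_norm R_proper R_convex R_lsc
                    F_convex F_C1 gradF_lip S0 a0 Ru)).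
rewrite lerD2l lerN2 ler_wpM2r ?sqr_ge0 //.
by move: La; rewrite ler_pdivrMr //; lra.
Qed.

Lemma line_search_test_window (u : nat -> H) k (alpha : K) : 0 < alpha ->
  (forall j, (j <= memory mmax k)%N -> edom R (u (k - j)%N)) ->
  line_search_test ip F R delta mmax u k alpha ->
  exists j, [/\ (j <= mmax)%N, psi (u k) <= psi (u (k - j)%N) &
    psi (T alpha (u k)) <=
      psi (u (k - j)%N) - delta * alpha * `|u k - T alpha (u k)| ^+ 2].
Proof.
move=> a0 dom; rewrite /line_search_test big_mkord.
have dT := T_dom ip_norm R_proper R_convex R_lsc S0 (u k) a0.
rewrite (bigmax_eq_arg _ (ord0 : 'I_(memory mmax k).+1)) //; last first.
  by move=> i _; rewrite leNye.
case: Order.TotalTheory.arg_maxP => //= j _ jmax.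
have jm : (j <= memory mmax k)%N by rewrite -ltnS.
have := jmax ord0 isT; rewrite /= subn0.
have dk : edom R (u k) by have := dom 0%N (leq0n _); rewrite subn0.
rewrite (PsiE F R_proper dk) (PsiE F R_proper (dom _ jm)) (PsiE F R_proper dT).
rewrite -EFinB !lee_fin sqr_G // => h1 h2.
by exists (val j); split=> //; exact: leq_trans jm (memory_le _ _).
Qed.

Let alpha_max := alpha_sup + eta * (L / (1 - delta)).

Lemma alpha_int_bounds (a : K) :
  alpha_inf <= alpha_int alpha_inf alpha_sup a <= alpha_sup.
Proof.
by rewrite /alpha_int le_max lexx /= ge_max (ltW alpha_inf_sup) /= ge_min lexx.
Qed.

Section Run.
Variables (alpha0 : K) (u : nat -> H).
Hypothesis run :
  nonmonotone_splitting ip F R delta mmax eta alpha_inf alpha_sup alpha0 u.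

(** An accepted step size is either the initial one, at most [alpha_sup], or
    [eta] times a rejected one, which lies below [L / (1 - delta)]. *)
Lemma run_step_size k : exists2 alpha,
  alpha_inf <= alpha <= alpha_max &
  line_search_test ip F R delta mmax u k alpha /\ u k.+1 = T alpha (u k).
Proof.
have /andP[d0 d1] := delta_01; have d1' : 0 < 1 - delta by rewrite subr_gt0.
have [aBB [alpha [i h]]] := run; have [_ _ aE [test least] uE] := h k.
exists (alpha k) => //; have /andP[lo hi] := alpha_int_bounds (aBB k).
set a := alpha_int _ _ _ in aE least lo hi.
have a0 : 0 < a by apply: lt_le_trans lo.
have Ld : 0 < L / (1 - delta) by rewrite divr_gt0.
have e0 : 0 < eta by apply: lt_trans eta_gt1.
rewrite aE; apply/andP; split.
  by apply: (le_trans lo); rewrite ler_peMr ?(ltW a0) // exprn_ege1 // ltW.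
case: (i k) least => [|n] least.
  by rewrite expr0 mulr1 (le_trans hi) // lerDl mulr_ge0 // ltW.
have : a * eta ^+ n < L / (1 - delta).
  rewrite ltNge; apply/negP => /(line_search_test_large u k).
  exact: least.
rewrite -(ltr_pM2l e0) => /ltW; rewrite exprS mulrCA => /le_trans; apply.
by rewrite /alpha_max lerDr; apply: le_trans (le_trans lo hi); rewrite ltW.
Qed.

Lemma run_dom k : edom R (u k.+1).
Proof.
have [a /andP[a1 _] [_ ->]] := run_step_size k.
by apply: (T_dom ip_norm R_proper R_convex R_lsc S0); apply: lt_le_trans a1.
Qed.

Lemma run_gap k s : S s -> psi (u k.+1) - psi s <=
  alpha_max * `|u k - u k.+1| * `|u k - s| + L * `|u k - u k.+1| ^+ 2.
Proof.
move=> Ss; have [a /andP[a1 a2] [_ ->]] := run_step_size k.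
have a0 : 0 < a by apply: lt_le_trans a1.
apply: (le_trans (psi_T_gap ip_norm R_proper R_convex R_lsc
                    F_convex F_C1 gradF_lip S0 (u k) a0 Ss)).
by rewrite lerD2r !ler_wpM2r.
Qed.

(** The starting point may lie outside the domain of [R]; from [1 + mmax] on it
    has left the window, and all the values compared are finite. *)
Lemma run_decrease k : (1 + mmax <= k)%N ->
  exists j, [/\ (j <= mmax)%N, psi (u k) <= psi (u (k - j)%N) &
    psi (u k.+1) <=
      psi (u (k - j)%N) - delta * alpha_inf * `|u k - u k.+1| ^+ 2].
Proof.
move=> mk; have [a /andP[a1 _] [test ->]] := run_step_size k.
have /andP[d0 _] := delta_01.
have a0 : 0 < a by apply: lt_le_trans a1.
have dom j : (j <= memory mmax k)%N -> edom R (u (k - j)%N).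
  move=> jm; have := leq_trans jm (memory_le _ _) => {}jm.
  have -> : (k - j = (k - j).-1.+1)%N by clear -mk jm; lia.
  exact: run_dom.
have [j [jm h1 h2]] := line_search_test_window a0 dom test.
exists j; split=> //; apply: (le_trans h2).
by rewrite lerD2l lerN2 ler_wpM2r ?sqr_ge0 // ler_pM2l.
Qed.

End Run.
End LineSearch.

(** * Quadratic growth on sublevel sets *)

Section Growth.
Context {K : realType} {H : completeNormedModType K}.
Variable ip : {dot H for idfun}.
Hypothesis ip_norm : forall u, ip u u = `|u| ^+ 2.
Variables (F : H -> K) (R : H -> \bar K).
Hypotheses (R_proper : proper_ereal R) (R_convex : convex_ereal R).
Hypothesis F_convex : convex_function [set: convex_lmodType H] F.
Hypothesis F_C1 : continuously_differentiable ip F.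
Variables (omega gamma : K).
Hypotheses (omega_gt0 : 0 < omega) (gamma_gt0 : 0 < gamma).
Hypothesis growth : forall u, edom (Psi F R) u ->
  (Psi F R u < Psi_star F R + omega%:E)%E ->
  (gamma%:E * edist_inf (S_star ip F R) u ^+ 2 <= Psi F R u - Psi_star F R)%E.
Variable s0 : H.
Hypothesis Ss0 : S_star ip F R s0.

Local Notation S := (S_star ip F R).
Local Notation D u := (fine (edist_inf S u)).
Local Notation e u := (F u + fine (R u) - (F s0 + fine (R s0))).

Let S0 : S !=set0. Proof. by exists s0. Qed.

Lemma excess_ge0 u : edom R u -> 0 <= e u.
Proof.
move=> Ru; rewrite subr_ge0.
exact: (S_star_minimizer ip_norm R_proper F_convex F_C1 Ss0 Ru).
Qed.

Lemma growth_near u : edom R u -> e u < omega -> D u ^+ 2 <= gamma^-1 * e u.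
Proof.
move=> Ru eu; have := growth (proj2 (edom_Psi F R_proper u) Ru).
rewrite (Psi_starE ip_norm R_proper F_convex F_C1 Ss0) (PsiE F R_proper Ru).
rewrite -EFinB -EFinD lte_fin -ltrBlDl => /(_ eu).
by rewrite (edist_infE S0) -EFin_expe -EFinM lee_fin ler_pdivlMl.
Qed.

(** Above the level [omega], shrink the segment from [u] towards an almost
    nearest minimizer by the factor [t = omega / (2 e u)]: convexity brings
    the excess down to [omega / 2], where the growth condition applies, and the
    shrinking scales the distance to the minimizers by [t]. *)
Lemma growth_on_sublevel (B : K) u : edom R u -> e u <= B ->
  D u ^+ 2 <= (gamma^-1 + 2 * B / (omega * gamma)) * e u.
Proof.
move=> Ru euB; have eu0 := excess_ge0 Ru.
have wg : 0 < omega * gamma by rewrite mulr_gt0.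
have [eu|eu] := ltP (e u) omega.
  apply: (le_trans (growth_near Ru eu)); rewrite ler_wpM2r // lerDl.
  by rewrite divr_ge0 ?(ltW wg) // mulr_ge0 // (le_trans eu0).
have eu1 : 0 < e u by apply: lt_le_trans eu.
have [t tdef] : exists t : K, t = omega / (2 * e u) by exists (omega / (2 * e u)).
have tE : t * e u = omega / 2.
  by rewrite tdef; field; rewrite gt_eqF.
have t01 : 0 < t < 1.
  by rewrite tdef divr_gt0 ?mulr_gt0 //= ltr_pdivrMr ?mulr_gt0 //; lra.
have /andP[t0 t1] := t01.
(* the bound on the distance that the growth condition gives at level [omega / 2] *)
pose b := Num.sqrt (omega / (2 * gamma)).
have b2 : b ^+ 2 = omega / (2 * gamma).
  by rewrite sqr_sqrtr // divr_ge0 ?mulr_ge0 // ltW.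
have shrink : t * D u <= b.
  apply/ler_addgt0Pr => eps eps0.
  have [s Ss us] := dist_approx S0 u eps0.
  have Rs := S_star_dom Ss.
  pose v := t *: u + (1 - t) *: s.
  have [Rv rv] := fine_convex R_proper R_convex t01 Ru Rs.
  have Fv := convex_segment F_convex u s t01.
  have ess : e s <= 0.
    by rewrite subr_le0; exact: (S_star_minimizer ip_norm R_proper F_convex F_C1 Ss
      (S_star_dom Ss0)).
  have ev : e v <= omega / 2.
    have ts : (1 - t) * e s <= 0 by rewrite mulr_ge0_le0 // subr_ge0 ltW.
    by rewrite -tE; lra.
  have Dv : D v <= b.
    rewrite -(@ler_pXn2r _ 2) ?nnegrE ?dist_ge0 ?sqrtr_ge0 // b2.
    have ev1 : e v < omega
      by rewrite (le_lt_trans ev) // gtr_pMr // invf_lt1 // ltr1n.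
    apply: (le_trans (growth_near Rv ev1)).
    have -> : omega / (2 * gamma) = gamma^-1 * (omega / 2).
      by field; rewrite gt_eqF.
    by rewrite ler_pM2l ?invr_gt0.
  have := dist_triangle S0 u v.
  have -> : u - v = (1 - t) *: (u - s).
    by rewrite /v scalerBr opprD addrA; congr (_ - _); rewrite scalerBl scale1r.
  rewrite normrZ gtr0_norm ?subr_gt0 // => Duv.
  have h : (1 - t) * `|u - s| <= (1 - t) * (D u + eps).
    by rewrite ler_pM2l ?subr_gt0 // ltW.
  have : t * eps >= 0 by rewrite mulr_ge0 // ltW.
  lra.
have sq : t ^+ 2 * D u ^+ 2 <= omega / (2 * gamma).
  rewrite -b2 -exprMn ler_pXn2r ?nnegrE ?sqrtr_ge0 //.
  by rewrite mulr_ge0 ?dist_ge0 // ltW.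
have : D u ^+ 2 <= 2 * e u / (omega * gamma) * e u.
  have -> : 2 * e u / (omega * gamma) * e u = (t ^+ 2)^-1 * (omega / (2 * gamma)).
    by rewrite tdef; field; rewrite !gt_eqF.
  by rewrite ler_pdivlMl ?exprn_gt0.
move=> /le_trans; apply; rewrite ler_wpM2r //.
apply: (@le_trans _ _ (2 * B / (omega * gamma))).
  by rewrite ler_wpM2r ?invr_ge0 ?mulr_ge0 ?ler_wpM2l // ltW.
by rewrite lerDr invr_ge0 ltW.
Qed.

End Growth.

(** * Linear convergence *)

Section Convergence.
Context {K : realType} {H : completeNormedModType K}.
Variable ip : {dot H for idfun}.
Hypothesis ip_norm : forall u, ip u u = `|u| ^+ 2.
Variables (F : H -> K) (R : H -> \bar K) (L : K).
Hypotheses (R_proper : proper_ereal R) (R_convex : convex_ereal R).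
Hypothesis R_lsc : lower_semicontinuous R.
Hypothesis F_convex : convex_function [set: convex_lmodType H] F.
Hypothesis F_C1 : continuously_differentiable ip F.
Hypothesis L_gt0 : 0 < L.
Hypothesis gradF_lip : L.-lipschitz (grad ip F).
Variables (omega gamma : K).
Hypotheses (omega_gt0 : 0 < omega) (gamma_gt0 : 0 < gamma).
Hypothesis growth : forall u, edom (Psi F R) u ->
  (Psi F R u < Psi_star F R + omega%:E)%E ->
  (gamma%:E * edist_inf (S_star ip F R) u ^+ 2 <= Psi F R u - Psi_star F R)%E.
Variables (delta : K) (mmax : nat) (eta alpha_inf alpha_sup : K).
Hypotheses (delta_01 : 0 < delta < 1) (eta_gt1 : 1 < eta).
Hypotheses (alpha_inf_gt0 : 0 < alpha_inf) (alpha_inf_sup : alpha_inf < alpha_sup).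
Variable s0 : H.
Hypothesis Ss0 : S_star ip F R s0.

Local Notation S := (S_star ip F R).
Local Notation D u := (fine (edist_inf S u)).
Local Notation e u := (F u + fine (R u) - (F s0 + fine (R s0))).

Let S0 : S !=set0. Proof. by exists s0. Qed.

Let alpha_max := alpha_sup + eta * (L / (1 - delta)).

(** The constant [P] of [contraction_factor] for the coefficients of
    [run_gap_dist] and [run_decrease]. *)
Definition step_ratio (kappa : K) : K :=
  (kappa * alpha_max ^+ 2 / 2 + L) / (delta * alpha_inf).

(** The contraction factor of the window maximum when the squared distance is at
    most [kappa] times the excess. *)
Definition window_factor (kappa : K) : K :=
  (2^-1 + step_ratio kappa) / (1 + step_ratio kappa).

Let alpha_max_gt0 : 0 < alpha_max.
Proof.
have /andP[d0 d1] := delta_01.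
have as0 := lt_trans alpha_inf_gt0 alpha_inf_sup.
have e0 := lt_trans ltr01 eta_gt1.
by rewrite addr_gt0 // mulr_gt0 // divr_gt0 // subr_gt0.
Qed.

Let c_gt0 : 0 < delta * alpha_inf.
Proof. by have /andP[d0 _] := delta_01; rewrite mulr_gt0. Qed.

Lemma window_factor_lt1 (kappa : K) : 0 < kappa -> window_factor kappa < 1.
Proof.
move=> k0; have P0 : 0 < step_ratio kappa.
  by rewrite divr_gt0 // addr_gt0 // !mulr_gt0 // ?invr_gt0 // exprn_gt0.
by rewrite /window_factor ltr_pdivrMr; lra.
Qed.

Section Run.
Variables (alpha0 : K) (u : nat -> H).
Hypothesis run :
  nonmonotone_splitting ip F R delta mmax eta alpha_inf alpha_sup alpha0 u.

Let dec := run_decrease ip_norm R_proper R_convex R_lsc F_convex F_C1 L_gt0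
  gradF_lip S0 delta_01 eta_gt1 alpha_inf_gt0 alpha_inf_sup run.

Lemma run_edom k : (1 <= k)%N -> edom R (u k).
Proof.
case: k => // k _; exact: (run_dom ip_norm R_proper R_convex R_lsc F_convex F_C1
  L_gt0 gradF_lip S0 delta_01 eta_gt1 alpha_inf_gt0 alpha_inf_sup run k).
Qed.

Lemma run_excess_ge0 k : (1 <= k)%N -> 0 <= e (u k).
Proof.
by move=> /run_edom; exact: (excess_ge0 ip_norm R_proper F_convex F_C1 Ss0).
Qed.

(** The distance need not be attained at this point, hence the approximation by
    minimizers almost nearest to [u k]. *)
Lemma run_gap_dist k : e (u k.+1) <=
  alpha_max * `|u k - u k.+1| * D (u k) + L * `|u k - u k.+1| ^+ 2.
Proof.
set x := `|_|.
have x0 : 0 <= alpha_max * x by rewrite mulr_ge0 ?normr_ge0 ?(ltW alpha_max_gt0).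
apply/ler_addgt0Pr => eps eps0.
have d0 : 0 < eps / (alpha_max * x + 1) by rewrite divr_gt0 // ltr_wpDl.
have [s Ss us] := dist_approx S0 (u k) d0.
have := run_gap ip_norm R_proper R_convex R_lsc F_convex F_C1 L_gt0
  gradF_lip S0 delta_01 eta_gt1 alpha_inf_gt0 alpha_inf_sup run k Ss.
have ss : F s + fine (R s) <= F s0 + fine (R s0).
  exact: (S_star_minimizer ip_norm R_proper F_convex F_C1 Ss (S_star_dom Ss0)).
have ds : alpha_max * x * `|u k - s| <=
    alpha_max * x * (D (u k) + eps / (alpha_max * x + 1)).
  by rewrite ler_wpM2l // ltW.
have de : alpha_max * x * (eps / (alpha_max * x + 1)) <= eps.
  have y1 : 0 < alpha_max * x + 1 by rewrite ltr_wpDl.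
  by rewrite mulrA ler_pdivrMr // mulrC ler_pM2l // lerDl.
rewrite -/x -/alpha_max; rewrite mulrDr in ds.
move: ss ds de; set y := alpha_max * x; set z := y * (_ / _); lra.
Qed.

Lemma run_linear_rate N (kappa sigma : K) : 0 < kappa -> 0 < sigma <= 1 ->
  window_factor kappa <= sigma ^+ mmax.+1 -> (1 <= N)%N ->
  (forall k, (N <= k)%N -> D (u k) ^+ 2 <= kappa * e (u k)) ->
  exists2 B, 0 <= B & forall k, (N <= k)%N -> e (u k) <= B * sigma ^+ k.
Proof.
move=> k0 s01 qs N1 hD.
apply: (@windowed_linear_rate _ (fun k => e (u k)) (fun k => D (u k))
  (fun k => `|u k - u k.+1|) mmax N alpha_max L (delta * alpha_inf) kappa
  (step_ratio kappa)) => //.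
- move=> k Nk; split; last exact: hD.
  by apply: run_excess_ge0; exact: leq_trans Nk.
- by move=> k _; exact: run_gap_dist.
- move=> k Nk; have [j [jm h1 h2]] := dec (leq_trans (leq_add N1 (leqnn _)) Nk).
  by exists j; split=> //=; lra.
Qed.

Lemma run_excess_bounded :
  exists2 B, 0 < B & forall k, (1 <= k)%N -> e (u k) <= B.
Proof.
have [|||||B B0 hB] := @windowed_geometric_bound _ (fun k => e (u k)) mmax 1 1 1.
- exact: ler01.
- by rewrite ltr01 lexx.
- by rewrite expr1n.
- exact: run_excess_ge0.
- move=> k mk; have [j [jm _ h]] := dec mk; exists j => //.
  rewrite mul1r lerD2r; apply: (le_trans h).
  by rewrite gerBl mulr_ge0 ?sqr_ge0 // ltW.
exists (B + 1); first by rewrite ltr_wpDl.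
by move=> k /hB; rewrite expr1n mulr1 => /le_trans; apply; rewrite lerDl.
Qed.

(** The growth condition first gives linear convergence with a rate depending
    on the level reached by the first iterates, hence enters the region where
    the growth constant [gamma] itself is available. *)
Lemma run_eventually_near :
  exists2 N, (1 <= N)%N & forall k, (N <= k)%N -> e (u k) < omega.
Proof.
have [B B0 hB] := run_excess_bounded.
pose kappa := gamma^-1 + 2 * B / (omega * gamma).
have k0 : 0 < kappa.
  by rewrite addr_gt0 ?invr_gt0 // divr_gt0 // mulr_gt0.
have [sigma s01 qs] := pow_below_one mmax.+1 (window_factor_lt1 k0).
have /andP[sg0 sg1] := s01.
have s01' : 0 < sigma <= 1 by rewrite sg0 ltW.
have [k k1|A A0 hA] := run_linear_rate k0 s01' qs (leqnn 1).
  by apply: (growth_on_sublevel ip_norm R_proper R_convex F_convex F_C1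
    omega_gt0 gamma_gt0 growth Ss0 (run_edom k1)); exact: hB.
have [N hN] := cvg0_of_geometric s01 omega_gt0 hA.
exists (maxn 1 N); first exact: leq_maxl.
by move=> k; rewrite geq_max => /andP[_]; exact: hN.
Qed.

Lemma run_rate (sigma : K) : 0 < sigma < 1 ->
  window_factor gamma^-1 <= sigma ^+ mmax.+1 ->
  exists N B, [/\ (1 <= N)%N, 0 <= B &
    forall k, (N <= k)%N -> [/\ e (u k) <= B * sigma ^+ k,
      D (u k) ^+ 2 <= B * sigma ^+ k &
      `|u k - u k.+1| ^+ 2 <= B * sigma ^+ k]].
Proof.
move=> /andP[sg0 sg1] qs; have [N N1 hN] := run_eventually_near.
have ig0 : 0 < gamma^-1 by rewrite invr_gt0.
have s01' : 0 < sigma <= 1 by rewrite sg0 ltW.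
have hD k : (N <= k)%N -> D (u k) ^+ 2 <= gamma^-1 * e (u k).
  move=> Nk; apply: (growth_near ip_norm R_proper F_convex F_C1
    gamma_gt0 growth Ss0); last exact: hN.
  by apply: run_edom; exact: leq_trans Nk.
have [A A0 hA] := run_linear_rate ig0 s01' qs N1 hD.
pose c := delta * alpha_inf; have c0 : 0 < c by exact: c_gt0.
pose A' := A / (c * sigma ^+ mmax).
have A'0 : 0 <= A' by rewrite divr_ge0 // mulr_ge0 ?exprn_ge0 // ltW.
exists (N + mmax)%N, (A + gamma^-1 * A + A'); split.
- exact: leq_trans N1 (leq_addr _ _).
- by rewrite !addr_ge0 // mulr_ge0 // ltW.
move=> k Nk; have Nk' : (N <= k)%N := leq_trans (leq_addr _ _) Nk.
have sk : 0 < sigma ^+ k by rewrite exprn_gt0.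
have x1 : 0 <= A * sigma ^+ k by rewrite mulr_ge0 // ltW.
have x2 : 0 <= gamma^-1 * A * sigma ^+ k by rewrite !mulr_ge0 // ltW.
have x3 : 0 <= A' * sigma ^+ k by rewrite mulr_ge0 // ltW.
split; rewrite 2!mulrDl.
- by have := hA k Nk'; lra.
- have : gamma^-1 * e (u k) <= gamma^-1 * (A * sigma ^+ k).
    by rewrite ler_pM2l // hA.
  have := hD k Nk'; lra.
have [j [jm _ h]] := dec (leq_trans (leq_add N1 (leqnn _)) Nk).
have Nkj : (N <= k - j)%N by rewrite leq_subRL; clear -Nk jm; lia.
have step : c * `|u k - u k.+1| ^+ 2 <= A * sigma ^+ (k - j).
  apply: le_trans (hA _ Nkj); rewrite -/c in h.
  by have := run_excess_ge0 (ltn0Sn k); lra.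
have pw : sigma ^+ mmax * sigma ^+ (k - j) <= sigma ^+ k.
  rewrite -exprD; apply: ler_wiXn2l; rewrite ?ltW //; clear -Nk jm; lia.
have : `|u k - u k.+1| ^+ 2 <= A' * sigma ^+ k.
  have cs0 : 0 < c * sigma ^+ mmax by rewrite (mulr_gt0 c0) // exprn_gt0.
  rewrite /A' mulrAC ler_pdivlMr //.
  rewrite mulrA mulrC (mulrC _ c).
  apply: (@le_trans _ _ (sigma ^+ mmax * (A * sigma ^+ (k - j)))).
    by rewrite ler_pM2l ?exprn_gt0.
  by rewrite mulrCA ler_wpM2l.
by move=> /le_trans; apply; rewrite lerDr addr_ge0.
Qed.

(** Along the run [R (u k)] is [e (u k) + Psi* - F (u k)], so lower
    semicontinuity of [R] and continuity of [F] bound [Psi] at the limit. *)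
Lemma run_limit_S_star N (B sigma : K) p : 0 < sigma < 1 -> (1 <= N)%N ->
  (forall k, (N <= k)%N -> e (u k) <= B * sigma ^+ k) ->
  u @ \oo --> p -> S p.
Proof.
move=> /andP[sg0 sg1] N1 he up.
have [dF _] := F_C1; have Fp := differentiable_continuous (dF p).
have Rp : (R p <= (0 + (F s0 + fine (R s0)) - F p)%:E)%E.
  apply: (@lsc_cvg_le _ _ R u p
    (fun k => B * sigma ^+ k + (F s0 + fine (R s0)) - F (u k))) => //.
    apply: cvgB; last exact: (cvg_comp _ _ up Fp).
    apply: cvgD; last exact: cvg_cst.
    rewrite -(mulr0 B); apply: cvgM; first exact: cvg_cst.
    by apply: cvg_expr; rewrite gtr0_norm.
  exists N => // k /= Nk.
  rewrite (properE R_proper (run_edom (leq_trans N1 Nk))) lee_fin.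
  by have := he k Nk; lra.
have dp : edom R p by apply: le_lt_trans Rp (ltry _).
apply: (minimizer_S_star ip_norm R_proper R_convex F_convex F_C1 gradF_lip dp).
move=> v Rv.
have := S_star_minimizer ip_norm R_proper F_convex F_C1 Ss0 Rv.
by move: Rp; rewrite (properE R_proper dp) lee_fin; lra.
Qed.

End Run.
End Convergence.

Theorem theorem4 (K : realType) (H : completeNormedModType K)
    (ip : {dot H for idfun}) (ip_norm : forall u, ip u u = `|u| ^+ 2)
    (F : H -> K) (R : H -> \bar K) (L : K)
    (R_proper : proper_ereal R) (R_convex : convex_ereal R)
    (R_lsc : lower_semicontinuous R)
    (F_convex : convex_function [set: convex_lmodType H] F)
    (F_C1 : continuously_differentiable ip F)
    (L_gt0 : 0 < L) (gradF_lip : L.-lipschitz (grad ip F))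
    (S_neq0 : S_star ip F R !=set0)
    (omega gamma : K) (omega_gt0 : 0 < omega) (gamma_gt0 : 0 < gamma)
    (growth : forall u, edom (Psi F R) u ->
       (Psi F R u < Psi_star F R + omega%:E)%E ->
       (gamma%:E * edist_inf (S_star ip F R) u ^+ 2
          <= Psi F R u - Psi_star F R)%E)
    (delta : K) (mmax : nat) (eta alpha_inf alpha_sup : K)
    (delta_01 : 0 < delta < 1) (eta_gt1 : 1 < eta)
    (alpha_inf_gt0 : 0 < alpha_inf) (alpha_inf_sup : alpha_inf < alpha_sup) :
  exists Cc Cd Cp sigma : K,
    [/\ 0 < Cc, 0 < Cd, 0 < Cp & 0 < sigma < 1] /\
    forall (alpha0 : K) (u : nat -> H), 0 < alpha0 ->
      nonmonotone_splitting ip F R delta mmax eta alpha_inf alpha_sup alpha0 u ->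
      exists kbar : nat,
        (forall k, (kbar <= k)%N ->
           (Psi F R (u k) - Psi_star F R <= (Cc * sigma ^+ k)%:E)%E /\
           (edist_inf (S_star ip F R) (u k) ^+ 2 <= (Cd * sigma ^+ k)%:E)%E) /\
        exists2 ustar : H, S_star ip F R ustar &
          u @ \oo --> ustar /\
          forall k, (kbar <= k)%N -> `|u k - ustar| ^+ 2 <= Cp * sigma ^+ k.
Proof.
have [s0 Ss0] := S_neq0.
have ig0 : 0 < gamma^-1 by rewrite invr_gt0.
have [sigma s01 qs] := pow_below_one mmax.+1 (window_factor_lt1 L_gt0 delta_01
  eta_gt1 alpha_inf_gt0 alpha_inf_sup ig0).
have /andP[sg0 sg1] := s01.
pose tau := (1 + sigma) / 2.
have st : 0 < sigma < tau by rewrite sg0 /tau; lra.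
exists 1, 1, 1, tau; split; first by rewrite ltr01 /tau; split=> //; lra.
move=> alpha0 u _ run.
have [N [B [N1 B0 hN]]] := run_rate ip_norm R_proper R_convex R_lsc F_convex
  F_C1 L_gt0 gradF_lip omega_gt0 gamma_gt0 growth delta_01 eta_gt1
  alpha_inf_gt0 alpha_inf_sup Ss0 run s01 qs.
have hstep k : (N <= k)%N -> `|u k - u k.+1| ^+ 2 <= B * sigma ^+ k.
  by move=> /hN[].
have [p up hp] := cvg_of_geometric_steps B0 s01 hstep.
have Sp : S_star ip F R p.
  have he k : (N <= k)%N -> F (u k) + fine (R (u k)) - (F s0 + fine (R s0)) <=
      B * sigma ^+ k by move=> /hN[].
  exact: (run_limit_S_star ip_norm R_proper R_convex R_lsc F_convex F_C1 L_gt0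
    gradF_lip delta_01 eta_gt1 alpha_inf_gt0 alpha_inf_sup Ss0 run s01 N1 he up).
have [M1 hM1] := geometric_absorb B0 st.
have Q0 : 0 <= B / (1 - Num.sqrt sigma) ^+ 2 by rewrite divr_ge0 ?sqr_ge0.
have [M2 hM2] := geometric_absorb Q0 st.
exists (maxn N (maxn M1 M2)); split.
  move=> k; rewrite !geq_max mul1r => /and3P[Nk M1k _].
  have [he hD _] := hN k Nk; have := hM1 k M1k => ht.
  have dk : edom R (u k).
    exact: (run_edom ip_norm R_proper R_convex R_lsc F_convex F_C1 L_gt0
      gradF_lip delta_01 eta_gt1 alpha_inf_gt0 alpha_inf_sup Ss0 run
      (leq_trans N1 Nk)).
  rewrite (Psi_starE ip_norm R_proper F_convex F_C1 Ss0) (PsiE F R_proper dk).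
  rewrite (edist_infE S_neq0) -EFin_expe -EFinB !lee_fin.
  by split; [exact: le_trans he ht|exact: le_trans hD ht].
exists p => //; split=> // k; rewrite !geq_max mul1r => /and3P[Nk _ M2k].
exact: le_trans (hp k Nk) (hM2 k M2k).
Qed.
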